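(* Let $n\geq 5$. Then the dimension of the diameter polytope $P^{n}_{\overline{\mathrm{TSD}}}$ of the symmetric traveling salesman problem satisfies $$\dim P^{n}_{\overline{\mathrm{TSD}}}=\frac{3n^{2}-7n}{2}.$$
   Context: $K_n$ is the complete graph with vertex set $V(K_n)=\{1,\ldots,n\}$ and edge set $E(K_n)$; the edge $\{i,j\}$ is written $ij$. $K_n[A]$ is the subgraph induced by $A\subseteq V(K_n)$, and $x(S)=\sum_{ij\in S}x_{ij}$ for $S\subseteq E(K_n)$. $\oplus$ denotes concatenation of vectors. $P^{n}_{\overline{\mathrm{TSD}}}\subseteq\mathbb{R}^{3\binom n2}$ is the convex hull of all $x\oplus y\oplus z\in\{0,1\}^{3\binom{n}{2}}$ (with $x,y,z$ indexed by $E(K_n)$) such that: $\sum_{j\neq i}x_{ij}=2$ and $\sum_{j\neq i}y_{ij}=2$ for all $i\in V(K_n)$; $x(E(K_n[A]))\leq|A|-1$ and $y(E(K_n[A]))\leq|A|-1$ for all nonempty proper subsets $A\subset V(K_n)$; and $x_{ij}+y_{ij}-z_{ij}\leq 1$ for all $ij\in E(K_n)$. The dimension of a polytope is the dimension of its affine hull. *)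

(* Defs.v *)
From HB Require Import structures.
From mathcomp Require Import all_boot all_order all_algebra.
From mathcomp Require Import all_classical reals convex.

Set Implicit Arguments.
Unset Strict Implicit.
Unset Printing Implicit Defensive.

Import Order.TTheory GRing.Theory Num.Theory.

Local Open Scope classical_set_scope.
Local Open Scope ring_scope.

Definition convex_hull (R : realType) (V : vectType R) (A : set V) : set V :=
  smallest (@convex_set R V) A.

Definition affine_set (R : realType) (V : vectType R) (A : set V) : Prop :=
  forall (x y : V) (t : R), A x -> A y -> A (t *: x + (1 - t) *: y).

Definition affine_hull (R : realType) (V : vectType R) (A : set V) : set V :=
  smallest (@affine_set R V) A.

(* The affine hull of a nonempty set is a translate p + U of a unique linear
   subspace U, and its dimension is that of U.  The default value -1 is only
   reached when A is empty. *)
Definition affine_dim (R : realType) (V : vectType R) (A : set V) : int :=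
  xget (- 1) [set d : int | exists (p : V) (U : {vspace V}),
                affine_hull A = [set v | v - p \in U] /\ d = (\dim U)%:Z].

Definition edge (n : nat) : predArgType := {e : {set 'I_n} | #|e| == 2%N}.

Definition edge_vec (R : realType) (n : nat) : Type := 'rV[R]_#|{: edge n}|.

Definition at_edge (R : realType) (n : nat) (x : edge_vec R n) (e : edge n) : R :=
  x ord0 (enum_rank e).

(* x_ij, where the edge ij is the set {i, j}; it is only used for i != j, the
   value for i = j being 0 by convention. *)
Definition at_pair (R : realType) (n : nat) (x : edge_vec R n) (i j : 'I_n) : R :=
  oapp (at_edge x) 0 (insub [set i; j]%SET).

Definition edge_sum (R : realType) (n : nat) (x : edge_vec R n)
    (S : {set edge n}) : R :=
  \sum_(e in S) at_edge x e.

Definition induced_edges (n : nat) (A : {set 'I_n}) : {set edge n} :=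
  [set e : edge n | val e \subset A]%SET.

Definition zero_one (R : realType) (n : nat) (x : edge_vec R n) : Prop :=
  forall e : edge n, at_edge x e = 0 \/ at_edge x e = 1.

Definition degree_eqs (R : realType) (n : nat) (x : edge_vec R n) : Prop :=
  forall i : 'I_n, \sum_(j | j != i) at_pair x i j = 2.

Definition subtour_ineqs (R : realType) (n : nat) (x : edge_vec R n) : Prop :=
  forall A : {set 'I_n}, A != finset.set0 -> A \proper [set: 'I_n]%SET ->
    edge_sum x (induced_edges A) <= #|A|%:R - 1.

Definition coupling_ineqs (R : realType) (n : nat) (x y z : edge_vec R n) : Prop :=
  forall i j : 'I_n, i != j -> at_pair x i j + at_pair y i j - at_pair z i j <= 1.

Definition diameter_points (R : realType) (n : nat) :
    set 'rV[R]_(#|{: edge n}| + #|{: edge n}| + #|{: edge n}|) :=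
  [set v | exists x y z : edge_vec R n,
     v = row_mx (row_mx x y) z /\
     (zero_one x /\ zero_one y /\ zero_one z) /\
     (degree_eqs x /\ degree_eqs y) /\
     (subtour_ineqs x /\ subtour_ineqs y) /\
     coupling_ineqs x y z].

Definition diameter_polytope (R : realType) (n : nat) :
    set 'rV[R]_(#|{: edge n}| + #|{: edge n}| + #|{: edge n}|) :=
  convex_hull (@diameter_points R n).

(* Main.v *)
Require Import Defs.
From HB Require Import structures.
From mathcomp Require Import all_boot all_order all_algebra.
From mathcomp Require Import all_classical reals convex.
From mathcomp Require Import perm ring lra.

Set Implicit Arguments.
Unset Strict Implicit.
Unset Printing Implicit Defensive.

Import Order.TTheory GRing.Theory Num.Theory.

Local Open Scope ring_scope.

(** Every tour satisfies the 2n degree equations, which are linearly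
    independent, so the polytope lies in a translate of the joint kernel K of
    these equations, a space of dimension 3 C(n,2) - 2n.  It remains to see that
    no further equation holds: an affine set B that contains all the 0/1 points
    contains the whole translate.  Since the directions of B form a linear
    subspace, it is enough to exhibit enough differences of 0/1 points.

    In the z block, every edge e is avoided by some tour.  With such a tour as
    x, the coordinate z_e is free, and switching it from 1 to 0 gives the unit
    direction of e ([tour_avoiding]).

    In the x block (and likewise in the y block), keep y fixed and z = 1.  A
    2-exchange turns a tour running i, j, k, l into one running i, k, j, l, and
    the difference is the alternating 4-cycle vector ij + kl - ik - jl
    ([tour_exchange]).  These vectors span the kernel of the degree map
    ([degree_ker_span]): there are vectors g_i with degree 1 at i and 0
    elsewhere, such that every edge ij equals g_i + g_j modulo alternating
    4-cycles ([edge_unit_modulo]).  Hence x is congruent to the sum of the g_i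
    weighted by its degrees, and to 0 when all of these vanish.  The same g_i
    show that the degree map is onto, whence the dimension of K.

    Tours are handled as successor functions s on the vertices, the incidence
    vector being the sum of the edges {i, s i}.  All the linear constraints are
    then checked edge by edge in this sum. *)

Local Ltac row_field := apply/rowP => ?; rewrite !mxE; field.

(** * Linear subspaces and affine sets *)

(** A Prop-valued notion, since it is applied to the set of directions of an
    arbitrary affine set, which has no reason to be decidable. *)
Definition subspace (R : pzRingType) (V : lmodType R) (Q : V -> Prop) : Prop :=
  Q 0 /\ forall (c : R) v w, Q v -> Q w -> Q (c *: v + w).

Section Subspace.
Variables (R : pzRingType) (V : lmodType R) (Q : V -> Prop).
Hypothesis Q_sub : subspace Q.

Lemma subspaceD v w : Q v -> Q w -> Q (v + w).
Proof. by move=> Qv Qw; rewrite -[v]scale1r; apply: (proj2 Q_sub). Qed.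

Lemma subspaceZ (c : R) v : Q v -> Q (c *: v).
Proof.
by case: Q_sub => Q0 Qlin Qv; rewrite -[_ *: _]addr0; apply: Qlin.
Qed.

Lemma subspaceB v w : Q v -> Q w -> Q (v - w).
Proof. by move=> Qv Qw; rewrite -scaleN1r; apply/subspaceD/subspaceZ. Qed.

Lemma subspace_preim (W : lmodType R) (f : W -> V) :
  linear f -> subspace (fun w => Q (f w)).
Proof.
case: Q_sub => Q0 Qlin f_lin; split; last first.
  by move=> c v w Qv Qw; rewrite f_lin; apply: Qlin.
by have := f_lin (-1) 0 0; rewrite scaler0 addr0 scaleN1r addNr => ->.
Qed.

Lemma subspace_sum (I : finType) (c : I -> R) (v : I -> V) :
  (forall i, Q (v i)) -> Q (\sum_i c i *: v i).
Proof.
move=> Qv; elim/big_ind: _ => [|v' w'|i _]; first exact: proj1 Q_sub.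
  exact: subspaceD.
exact: subspaceZ.
Qed.
End Subspace.

Section Affine.
Variables (R : realType) (V : vectType R).
Implicit Types (A B : set V) (p v w : V) (U : {vspace V}).
Local Open Scope classical_set_scope.

(** The direction space of a translate is determined by the set, so the
    value selected in [affine_dim] is the expected one. *)
Lemma affine_dim_translate A p U :
  affine_hull A = [set v | v - p \in U] -> affine_dim A = (\dim U)%:Z.
Proof.
move=> AU; apply: xget_unique; first by exists p, U.
move=> _ [p' [U' [AU' ->]]]; congr (\dim _)%:Z.
have pU' : p - p' \in U'.
  have : [set v | v - p \in U] p by rewrite /= subrr mem0v.
  by rewrite -AU AU'.
apply/vspaceP => v; transitivity ((v + p) - p \in U); last by rewrite addrK.
have : [set v | v - p \in U] (v + p) = [set v | v - p' \in U'] (v + p).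
  by rewrite -AU AU'.
move=> /= UU'; have -> : (v + p - p \in U) = (v + p - p' \in U').
  by apply/idP/idP; rewrite UU'.
rewrite -addrA; apply/idP/idP => [vU'|vpU']; first by rewrite memvD.
by rewrite -(addrK (p - p') v) memvB.
Qed.

(** A homothety centred at p is an affine combination with p, and a sum of
    directions is the midpoint of the doubled directions. *)
Lemma affine_direction B p :
  affine_set B -> B p -> subspace (fun v => B (p + v)).
Proof.
move=> B_aff Bp.
have BZ (c : R) v : B (p + v) -> B (p + c *: v).
  move=> Bv; have := B_aff _ _ c Bv Bp; congr B.
  by rewrite scalerDr scalerBl scale1r [c *: p + _]addrC -addrA
    [c *: p + (_ - _)]addrC subrK addrC.
split; first by rewrite addr0.
move=> c v w Bv Bw.
have := B_aff _ _ 2^-1 (BZ (2 * c) v Bv) (BZ 2 w Bw); congr B.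
have half : 1 - 2^-1 = 2^-1 :> R by field.
rewrite half -scalerDr addrACA -scalerA -scalerDr -mulr2n.
rewrite -[p *+ 2]scaler_nat -scalerDr.
by rewrite scalerA mulVf ?scale1r // pnatr_eq0.
Qed.

Lemma affine_set_diff B p v w :
  affine_set B -> B p -> B v -> B w -> B (p + (v - w)).
Proof.
move=> B_aff Bp Bv Bw; have dirB := affine_direction B_aff Bp.
have -> : v - w = (v - p) - (w - p) by rewrite opprB addrA subrK.
by apply: (subspaceB dirB); rewrite addrC subrK.
Qed.

Lemma affine_set_convex B : affine_set B -> convex_set B.
Proof. by move=> B_aff x y t; rewrite !inE => Bx By; apply: B_aff. Qed.

Lemma affine_hull_convex_hull A : affine_hull (convex_hull A) = affine_hull A.
Proof.
apply/seteqP; split; apply: smallest_sub => [x y t Ax Ay B [B_aff BA]|v Av].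
- by apply: (B_aff); [apply: Ax | apply: Ay].
- move=> B [B_aff BA]; apply: Av; split=> //; exact: affine_set_convex.
- by apply: (B_aff); [apply: Ax | apply: Ay].
- by move=> B [_]; apply; apply: sub_gen_smallest.
Qed.

Lemma affine_hull_translate A p U : A p ->
  A `<=` [set v | v - p \in U] ->
  (forall B, affine_set B -> A `<=` B -> forall v, v \in U -> B (p + v)) ->
  affine_hull A = [set v | v - p \in U].
Proof.
move=> Ap AU UB; apply/seteqP; split.
  apply: smallest_sub => // x y t xU yU; rewrite /= in xU yU *.
  have -> : t *: x + (1 - t) *: y - p = t *: (x - p) + (1 - t) *: (y - p).
    by rewrite !scalerBr addrACA -opprD -scalerDl [t + _]addrC subrK scale1r.
  by rewrite memvD ?memvZ.
move=> v vU B [B_aff AB]; rewrite -(subrK p v) addrC; exact: UB.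
Qed.
End Affine.

(** * Hamiltonian successor functions *)

Lemma fresh_elt (T : finType) (c : seq T) :
  (size c < #|T|)%N -> exists i, i \notin c.
Proof.
move=> c_small; case: (pickP [pred i | i \notin c]) => [i ic|none].
  by exists i.
move: c_small; rewrite ltnNge (leq_trans _ (card_size c)) //.
by apply/subset_leq_card/fintype.subsetP => i _; have /negbFE := none i.
Qed.

(** The injective functions whose functional graph is one cycle through all of
    T.  Stating it by closed sets is what the subtour inequalities use: a proper
    nonempty vertex set is left by some edge. *)
Definition hamiltonian (T : finType) (s : T -> T) : Prop :=
  injective s /\
  forall A : {set T}, A != finset.set0 -> {in A, forall i, s i \in A} ->
    A = [set: T]%SET.

Lemma hamiltonian_conj (T : finType) (s t : T -> T) :
  involutive t -> hamiltonian s -> hamiltonian (t \o s \o t).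
Proof.
move=> tK [s_inj s_full]; split.
  by do 2![apply: inj_comp => //]; apply: inv_inj.
move=> A /set0Pn[i Ai] A_closed.
have/setP tA_full : [set j | t j \in A]%SET = [set: T]%SET.
  apply: s_full; first by apply/set0Pn; exists (t i); rewrite inE tK.
  by move=> j; rewrite !inE => /A_closed /=; rewrite tK.
by apply/setP => j; have := tA_full (t j); rewrite !inE tK.
Qed.

Lemma hamiltonian_next (T : finType) (c : seq T) :
  uniq c -> (forall i, i \in c) -> hamiltonian (next c).
Proof.
move=> c_uniq c_full; split; first exact: can_inj (prev_next c_uniq).
move=> A /set0Pn[i Ai] A_closed; apply/setP => j; rewrite inE.
have ij : fconnect (next c) i j.
  by rewrite (fconnect_cycle (cycle_next c_uniq)) c_full.
rewrite -(iter_findex ij); elim: (findex _ _ _) => //= m; exact: A_closed.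
Qed.

Lemma hamiltonian_path4 (T : finType) (i j k l : T) :
  uniq [:: i; j; k; l] ->
  exists s : T -> T, [/\ hamiltonian s, s i = j, s j = k & s k = l].
Proof.
move=> ijkl.
pose c := [:: i; j; k; l] ++ [seq m <- enum T | m \notin [:: i; j; k; l]].
exists (next c); split.
- apply: hamiltonian_next => [|m].
    rewrite cat_uniq ijkl filter_uniq ?enum_uniq // andbT.
    by apply/hasPn => m; rewrite mem_filter => /andP[].
  by rewrite mem_cat mem_filter mem_enum andbT orbN.
- by rewrite /= eqxx.
- move: ijkl; rewrite /= !inE !negb_or => /andP[/and3P[ij _ _] _].
  by rewrite eq_sym (negPf ij) eqxx.
- move: ijkl; rewrite /= !inE !negb_or => /and3P[/and3P[_ ik _] /andP[jk _] _].
  by rewrite !(eq_sym k) (negPf ik) (negPf jk) eqxx.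
Qed.

Lemma hamiltonian_nofix (T : finType) (s : T -> T) :
  (1 < #|T|)%N -> hamiltonian s -> forall i, s i != i.
Proof.
move=> T_gt1 [_ s_full] i; apply: contraTneq T_gt1 => si; rewrite -leqNgt.
rewrite -cardsT -(s_full [set i]%SET) ?cards1 //.
  by apply/set0Pn; exists i; rewrite inE.
by move=> j /set1P->; rewrite inE si.
Qed.

Lemma hamiltonian_no2cycle (T : finType) (s : T -> T) :
  (2 < #|T|)%N -> hamiltonian s -> forall i, s (s i) != i.
Proof.
move=> T_gt2 [_ s_full] i; apply: contraTneq T_gt2 => ssi; rewrite -leqNgt.
rewrite -cardsT -(s_full [set i; s i]%SET) ?cards2 ?ltnS ?leq_b1 //.
  by apply/set0Pn; exists i; rewrite !inE eqxx.
by move=> j /set2P[]->; rewrite !inE ?ssi eqxx ?orbT.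
Qed.

Lemma eq_set2 (T : finType) (a b i j : T) :
  ([set i; j]%SET == [set a; b]%SET)
    = (i == a) && (j == b) || (i == b) && (j == a).
Proof.
apply/eqP/orP => [/setP ij_ab|]; last first.
  by case=> [] /andP[/eqP-> /eqP->] //; apply: finset.setUC.
have := (ij_ab a, ij_ab b, ij_ab i, ij_ab j); rewrite !inE !eqxx !orbT /=.
rewrite !(eq_sym a) !(eq_sym b).
case=> [[[]]]; case: (i == a); case: (i == b); case: (j == a); case: (j == b);
  by auto.
Qed.

(** * Edge vectors, degrees and tours *)

Section EdgeVectors.
Variables (R : realType) (n : nat).
Local Notation E := #|{: edge n}|.
Implicit Types (x y : 'rV[R]_E) (i j a b : 'I_n) (s : 'I_n -> 'I_n).

Lemma at_pair_edge x i j (e : edge n) :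
  val e = [set i; j]%SET -> at_pair x i j = at_edge x e.
Proof. by move=> eij; rewrite /at_pair -eij valK. Qed.

Lemma edgeP (e : edge n) : exists a b, a != b /\ val e = [set a; b]%SET.
Proof. exact/cards2P/(valP e). Qed.

Lemma pair_edge i j : i != j -> exists e : edge n, val e = [set i; j]%SET.
Proof.
move=> ij; have ij2 : #|[set i; j]%SET| == 2%N by rewrite cards2 ij.
by exists (Sub [set i; j]%SET ij2); rewrite SubK.
Qed.

(** Indexing by two vertices, without a proof that they differ, allows
    alternating cycles and tours to be written as plain sums; the value is 0
    on the diagonal. *)
Definition edge_unit a b : 'rV[R]_E :=
  \row_k (val (enum_val k) == [set a; b]%SET)%:R.

Lemma at_edge_unit a b (e : edge n) :
  at_edge (edge_unit a b) e = (val e == [set a; b]%SET)%:R.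
Proof. by rewrite /at_edge mxE enum_rankK. Qed.

Lemma edge_unitC a b : edge_unit a b = edge_unit b a.
Proof. by rewrite /edge_unit finset.setUC. Qed.

Lemma at_pair_unit a b i j : i != j ->
  at_pair (edge_unit a b) i j = ([set i; j]%SET == [set a; b]%SET)%:R.
Proof.
by case/pair_edge => e eij; rewrite (at_pair_edge _ eij) at_edge_unit eij.
Qed.

Lemma edge_unit_delta k : exists a b, a != b /\ delta_mx 0 k = edge_unit a b.
Proof.
have [a [b [ab kab]]] := edgeP (enum_val k); exists a, b; split=> //.
apply/rowP => m; rewrite !mxE -kab eqxx /=.
by rewrite val_eqE (inj_eq enum_val_inj).
Qed.

Definition degree x : 'rV[R]_n := \row_i \sum_(j | j != i) at_pair x i j.

Fact degree_is_linear : linear degree.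
Proof.
move=> c x y; apply/rowP => i; rewrite !mxE mulr_sumr -big_split /=.
apply: eq_bigr => j; rewrite eq_sym => /pair_edge[e eij].
by rewrite !(at_pair_edge _ eij) /at_edge !mxE.
Qed.
HB.instance Definition _ :=
  GRing.isLinear.Build R 'rV[R]_E 'rV[R]_n _ degree degree_is_linear.

Lemma degree_unit a b : a != b ->
  degree (edge_unit a b) = delta_mx 0 a + delta_mx 0 b.
Proof.
move=> ab; apply/rowP => i; rewrite !mxE eqxx /=.
have sum_end (c d : 'I_n) : c != d ->
    \sum_(j | j != i) ((i == c) && (j == d))%:R = (i == c)%:R :> R.
  case: (eqVneq i c) => [->|_] cd; last by rewrite big1.
  by rewrite (bigD1 d) 1?eq_sym //= eqxx big1 ?addr0 // => j /andP[_ /negPf->].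
rewrite -(sum_end a b) // -(sum_end b a) 1?eq_sym // -big_split /=.
apply: eq_bigr => j ji; rewrite at_pair_unit; last by rewrite eq_sym.
rewrite eq_set2.
case: (eqVneq i a) => [->|_] /=; last by rewrite add0r.
by rewrite (negPf ab) /= orbF addr0.
Qed.

Definition tour s : 'rV[R]_E := \sum_i edge_unit i (s i).

Lemma at_edge_tour s (e : edge n) :
  at_edge (tour s) e = \sum_i (val e == [set i; s i]%SET)%:R.
Proof.
by rewrite /at_edge summxE; apply: eq_bigr => i _; rewrite mxE enum_rankK.
Qed.

Lemma degree_eqsE x : degree_eqs x <-> degree x = const_mx 2.
Proof.
by split=> [x2|/rowP x2 i]; [apply/rowP => i | have := x2 i]; rewrite !mxE.
Qed.

Lemma degree_tour s :
  (1 < n)%N -> hamiltonian s -> degree (tour s) = const_mx 2.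
Proof.
move=> n_gt1 s_ham; rewrite linear_sum /=.
have nofix i : i != s i.
  by rewrite eq_sym; apply: hamiltonian_nofix; rewrite ?card_ord.
rewrite (eq_bigr _ (fun i _ => degree_unit (nofix i))) big_split /=.
have <- : \sum_i 'e_i = \sum_i 'e_(s i) :> 'rV[R]_n.
  exact: reindex_inj (proj1 s_ham).
apply/rowP => i; rewrite !mxE summxE (bigD1 i) //= !mxE !eqxx big1 ?addr0 //.
by move=> j; rewrite mxE eq_sym => /negPf->; rewrite andbF.
Qed.

(** An edge that occurs twice in the sum defining the tour would be a 2-cycle
    of s. *)
Lemma zero_one_tour s : (2 < n)%N -> hamiltonian s -> zero_one (tour s).
Proof.
move=> n_gt2 s_ham e; rewrite at_edge_tour.
case: (pickP (fun i => val e == [set i; s i]%SET)) => [i ei|none]; last first.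
  by left; rewrite big1 // => i _; rewrite none.
right; rewrite (bigD1 i) //= ei big1 ?addr0 // => j ji.
rewrite (eqP ei) eq_set2 eq_sym (negPf ji) /=.
case: eqVneq => //= ->; rewrite (negPf (hamiltonian_no2cycle _ _ _)) //.
by rewrite card_ord.
Qed.

(** The tour edges inside A are counted by the vertices i of A with s i in A;
    these cannot be all of A, which would then be closed under s. *)
Lemma subtour_ineqs_tour s : hamiltonian s -> subtour_ineqs (tour s).
Proof.
move=> [_ s_full] A A_neq0 A_proper; rewrite /edge_sum.
under eq_bigr => e _ do rewrite at_edge_tour.
rewrite exchange_big /=.
have inside i : \sum_(e in induced_edges A) (val e == [set i; s i]%SET)%:R
    <= ((i \in A) && (s i \in A))%:R :> R.
  have [/andP[iA siA]|iA] := boolP ((i \in A) && (s i \in A)); last first.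
    rewrite big1 // => e; rewrite inE => eA.
    case: eqP eA => // ->.
    by rewrite finset.subUset !finset.sub1set (negPf iA).
  case: (pickP (fun e : edge n => val e == [set i; s i]%SET)) => [e ei|none].
    rewrite (bigD1 e) ?inE (eqP ei) ?finset.subUset ?finset.sub1set ?iA //=.
    rewrite eqxx big1 ?addr0 //.
    by move=> e' /andP[_ e'e]; rewrite -(eqP ei) val_eqE (negPf e'e).
  by rewrite big1 // => e _; rewrite none.
apply: (le_trans (ler_sum _ (fun i _ => inside i))).
have -> : \sum_i ((i \in A) && (s i \in A))%:R
    = #|[pred i in A | s i \in A]|%:R :> R.
  rewrite -sum1_card natr_sum [RHS]big_mkcond /=.
  by apply: eq_bigr => i _; rewrite inE; case: ifP.
rewrite lerBrDr natr1 ler_nat; apply: proper_card; rewrite properE.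
apply/andP; split; first by apply/fintype.subsetP => i /andP[].
move: A_proper; rewrite properE => /andP[_]; apply: contra => A_closed.
rewrite (s_full A) // => i iA.
by have /andP[] := fintype.subsetP A_closed i iA.
Qed.

(** The second tour is the first one relabelled by exchanging j and k, which
    changes the successors of i, j and k only; the edge jk is traversed in the
    opposite direction. *)
Lemma tour_exchange i j k l : uniq [:: i; j; k; l] ->
  exists s s', [/\ hamiltonian s, hamiltonian s' &
    tour s - tour s' =
      edge_unit i j + edge_unit k l - edge_unit i k - edge_unit j l].
Proof.
move=> ijkl; have [s [s_ham si sj sk]] := hamiltonian_path4 ijkl.
pose t := tperm j k; exists s, (t \o s \o t); split=> //.
  exact: hamiltonian_conj (@tpermK _ _ _) s_ham.
move: ijkl; rewrite /= !inE !negb_or andbT.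
move=> /and3P[/and3P[ij ik _] /andP[jk jl] kl].
have ti : t i = i by rewrite tpermD 1?eq_sym.
have tl : t l = l by rewrite tpermD.
have tj : t j = k by rewrite tpermL.
have tk : t k = j by rewrite tpermR.
rewrite /tour -sumrB (bigD1 i) //= (bigD1 j) 1?eq_sym //=.
rewrite (bigD1 k) /=; last first.
  by rewrite !(eq_sym k) ik jk.
rewrite ti tj tk si sj sk tj tk tl.
rewrite big1 => [|m /andP[/andP[mi mj] mk]]; last first.
  have s_inj := proj1 s_ham.
  rewrite [t m]tpermD 1?eq_sym // tpermD ?subrr //.
    by rewrite -si (inj_eq s_inj) eq_sym.
  by rewrite -sj (inj_eq s_inj) eq_sym.
rewrite (edge_unitC k j) addr0.
by row_field.
Qed.
End EdgeVectors.

(** * The kernel of the degree map *)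

Section Span.
Variables (R : realType) (n : nat).
Local Notation E := #|{: edge n}|.
Local Notation u := (@edge_unit R n).
Implicit Types (x y : 'rV[R]_E) (i j a b : 'I_n) (s : 'I_n -> 'I_n).

Lemma three_vertices : (3 <= n)%N -> exists o p q : 'I_n, uniq [:: o; p; q].
Proof.
move=> n_ge3.
have [o _] := @fresh_elt 'I_n [::]
  ltac:(by rewrite card_ord (ltn_trans _ n_ge3)).
have [p] := @fresh_elt _ [:: o] ltac:(by rewrite card_ord ltnW).
have [q] := @fresh_elt _ [:: o; p] ltac:(by rewrite card_ord).
rewrite !inE !negb_or => /andP[qo qp] po; exists o, p, q.
by rewrite /= !inE negb_or (eq_sym o p) po (eq_sym o) qo (eq_sym p) qp.
Qed.

(** A tour running a, k, b, l contains ab only if k = b or l = a. *)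
Lemma tour_avoiding (e : edge n) : (4 <= n)%N ->
  exists2 s, hamiltonian s & at_edge (tour R s) e = 0.
Proof.
move=> n_ge4; have [a [b [ab eab]]] := edgeP e.
have [k] := @fresh_elt _ [:: a; b] ltac:(by rewrite card_ord ltnW).
have [l] := @fresh_elt _ [:: a; b; k] ltac:(by rewrite card_ord).
rewrite !inE !negb_or => /and3P[la lb lk] /andP[ka kb].
have [|s [s_ham sa sk sb]] := @hamiltonian_path4 _ a k b l.
  by rewrite /= !inE !negb_or ab (eq_sym a k) ka (eq_sym a l) la kb
    (eq_sym k l) lk (eq_sym b l) lb.
exists s => //; rewrite at_edge_tour big1 // => i _; rewrite eab eq_set2.
case: (eqVneq a i) => [<-|_] /=; first
  by rewrite sa (eq_sym b k) (negPf kb) (eq_sym a k) (negPf ka).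
by case: (eqVneq b i) => [<-|]; rewrite ?andbF // sb eq_sym (negPf la).
Qed.

(** A vector with degree 1 at i and 0 elsewhere.  Half of an odd cycle with
    alternating signs does this at o, for which the triangle opq is used; the
    edge oi transfers it to the other vertices. *)
Definition vertex_vec (o p q i : 'I_n) : 'rV[R]_E :=
  let half := 2^-1 *: (u o p + u o q - u p q) in
  if i == o then half else u o i - half.

Lemma degree_vertex_vec (o p q i : 'I_n) : uniq [:: o; p; q] ->
  degree (vertex_vec o p q i) = 'e_i.
Proof.
rewrite /= !inE negb_or andbT => /andP[/andP[op oq] pq].
have half_o : degree (2^-1 *: (u o p + u o q - u p q)) = 'e_o.
  rewrite linearZ linearB linearD /= !degree_unit //.
  by row_field.
rewrite /vertex_vec; case: eqVneq => [->//|io].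
by rewrite linearB /= half_o degree_unit 1?eq_sym // addrC addKr.
Qed.

Lemma degree_surj (d : 'rV[R]_n) : (3 <= n)%N -> exists x, degree x = d.
Proof.
case/three_vertices => o [p [q opq]].
exists (\sum_i d 0 i *: vertex_vec o p q i).
rewrite linear_sum [RHS]row_sum_delta; apply: eq_bigr => i _.
by rewrite linearZ /= degree_vertex_vec.
Qed.

(** The difference vanishes when i or j is o.  Otherwise it is
    ij - oi - oj + op + oq - pq, which is zero or an alternating 4-cycle when
    one of i, j is p or q, and the sum of the alternating cycles on i, j, p, o
    and on p, j, o, q in the remaining case. *)
Lemma edge_unit_modulo (Q : 'rV[R]_E -> Prop) (o p q i j : 'I_n) :
  subspace Q ->
  (forall i j k l, uniq [:: i; j; k; l] -> Q (u i j + u k l - u i k - u j l)) ->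
  uniq [:: o; p; q] -> i != j ->
  Q (u i j - vertex_vec o p q i - vertex_vec o p q j).
Proof.
move=> Q_sub Qalt; have Q0 := proj1 Q_sub.
rewrite /= !inE negb_or andbT => /andP[/andP[op oq] pq].
move=> ij; rewrite /vertex_vec.
case: (eqVneq i o) => [io|io]; case: (eqVneq j o) => [jo|jo].
- by rewrite io jo eqxx in ij.
- rewrite io (_ : _ - _ = 0) //.
  by row_field.
- rewrite jo (edge_unitC _ i) (_ : _ - _ = 0) //.
  by row_field.
set w := _ - _.
have {w}-> : w = u i j - u o i - u o j + u o p + u o q - u p q.
  by row_field.
have alt_p k : k != o -> k != p -> k != q -> Q (u p k - u o k + u o q - u p q).
  move=> ko kp kq; have := Qalt p k q o.
  rewrite /= !inE !negb_or (eq_sym p k) kp pq (eq_sym p o) op kq ko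
    (eq_sym q o) oq.
  move=> /(_ isT); congr Q; rewrite (edge_unitC _ k) (edge_unitC _ q).
  by row_field.
have alt_q k : k != o -> k != p -> k != q -> Q (u q k - u o k + u o p - u p q).
  move=> ko kp kq; have := Qalt q k p o.
  rewrite /= !inE !negb_or (eq_sym q k) kq (eq_sym q p) pq (eq_sym q o) oq kp ko
    (eq_sym p o) op.
  move=> /(_ isT); congr Q.
  rewrite (edge_unitC _ k) (edge_unitC _ p o) (edge_unitC _ q p).
  by row_field.
have Q_eq v w : v = w -> Q v -> Q w by move=> ->.
case: (eqVneq i p) => [ip|ip].
  case: (eqVneq j q) => [jq|jq].
    rewrite ip jq (_ : _ - _ = 0) //.
    by row_field.
  rewrite ip in ij *; apply: Q_eq (alt_p j _ _ _); rewrite 1?[j == p]eq_sym //.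
  by row_field.
case: (eqVneq i q) => [iq|iq].
  rewrite iq; case: (eqVneq j p) => [jp|jp].
    rewrite jp (edge_unitC _ q) (_ : _ - _ = 0) //.
    by row_field.
  rewrite iq in ij; apply: Q_eq (alt_q j _ _ _); rewrite 1?[j == q]eq_sym //.
  by row_field.
case: (eqVneq j p) => [jp|jp].
  rewrite jp (edge_unitC _ i); apply: Q_eq (alt_p i _ _ _) => //.
  by row_field.
case: (eqVneq j q) => [jq|jq].
  rewrite jq (edge_unitC _ i); apply: Q_eq (alt_q i _ _ _) => //.
  by row_field.
have ijop : uniq [:: i; j; o; p].
  by rewrite /= !inE !negb_or ij io ip jo jp op.
apply: Q_eq (subspaceD Q_sub (Qalt i j o p ijop) (alt_p j jo jp jq)).
rewrite (edge_unitC _ i o) (edge_unitC _ j p).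
by row_field.
Qed.

(** The map sending x to x minus the combination of the vertex vectors weighted
    by the degrees of x is linear, is the identity on the kernel, and sends
    every edge into Q. *)
Lemma degree_ker_span (Q : 'rV[R]_E -> Prop) : (3 <= n)%N -> subspace Q ->
  (forall i j k l, uniq [:: i; j; k; l] -> Q (u i j + u k l - u i k - u j l)) ->
  forall x, degree x = 0 -> Q x.
Proof.
move=> n_ge3 Q_sub Qalt x x_ker.
have [o [p [q opq]]] := three_vertices n_ge3.
pose g := vertex_vec o p q.
have -> : x = \sum_k x 0 k *: ('e_k - \sum_i degree ('e_k) 0 i *: g i).
  rewrite (eq_bigr _ (fun k _ => scalerBr _ _ _)) sumrB -row_sum_delta.
  rewrite [X in _ - X](_ : _ = \sum_i degree x 0 i *: g i).
    by rewrite x_ker big1 ?subr0 // => i _; rewrite mxE scale0r.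
  under eq_bigr => k _ do rewrite scaler_sumr.
  rewrite exchange_big; apply: eq_bigr => i _ /=.
  rewrite [x in RHS]row_sum_delta linear_sum summxE scaler_suml.
  by apply: eq_bigr => k _; rewrite scalerA linearZ [in RHS]mxE.
apply: subspace_sum => // k; have [i [j [ij ->]]] := edge_unit_delta R k.
suff -> : \sum_m degree (u i j) 0 m *: g m = g i + g j.
  by rewrite opprD addrA; apply: edge_unit_modulo.
rewrite degree_unit //; under eq_bigr => m _ do rewrite mxE scalerDl.
have pick (c : 'I_n) : \sum_m ('e_c : 'rV[R]_n) 0 m *: g m = g c.
  rewrite (bigD1 c) //= mxE !eqxx scale1r big1 ?addr0 // => m /negPf mc.
  by rewrite mxE mc andbF scale0r.
by rewrite big_split /= !pick.
Qed.
End Span.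

(** * The affine hull of the 0/1 points *)

Section Polytope.
Variables (R : realType) (n : nat).
Local Notation E := #|{: edge n}|.
Local Notation P := ('rV[R]_(E + E + E)).
Implicit Types (x y z : 'rV[R]_E) (s : 'I_n -> 'I_n).

Definition triple x y z : P := row_mx (row_mx x y) z.

Lemma tripleP (v : P) : exists x y z, v = triple x y z.
Proof.
by exists (lsubmx (lsubmx v)), (rsubmx (lsubmx v)), (rsubmx v);
  rewrite /triple !hsubmxK.
Qed.

Definition degrees (v : P) : 'rV[R]_(n + n) :=
  row_mx (degree (lsubmx (lsubmx v))) (degree (rsubmx (lsubmx v))).

Lemma degrees_triple x y z :
  degrees (triple x y z) = row_mx (degree x) (degree y).
Proof. by rewrite /degrees /triple !(row_mxKl, row_mxKr). Qed.

Fact degrees_is_linear : linear degrees.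
Proof.
by move=> c v w; rewrite /degrees !linearP /= scale_row_mx add_row_mx.
Qed.
HB.instance Definition _ :=
  GRing.isLinear.Build R P 'rV[R]_(n + n) _ degrees degrees_is_linear.

Definition degree_ker : {vspace P} := lker (linfun degrees).

Lemma mem_degree_ker x y z :
  (triple x y z \in degree_ker) = (degree x == 0) && (degree y == 0).
Proof. by rewrite memv_ker lfunE /= degrees_triple row_mx_eq0. Qed.

Lemma card_edge : #|{: edge n}| = 'C(n, 2).
Proof.
rewrite card_sig -(card_ord n) -card_draws card_ord; apply: eq_card => e.
by rewrite !inE.
Qed.

Lemma dim_degree_ker : (3 <= n)%N ->
  (\dim degree_ker + 2 * n)%N = (3 * 'C(n, 2))%N.
Proof.
move=> n_ge3; rewrite mul2n -addnn.
have := limg_ker_dim (linfun degrees) fullv.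
have -> : (linfun degrees @: fullv)%VS = fullv.
  apply/vspaceP => d; rewrite memvf -[d]hsubmxK.
  have [x dx] := degree_surj (lsubmx d) n_ge3.
  have [y dy] := degree_surj (rsubmx d) n_ge3.
  rewrite -dx -dy -(degrees_triple x y 0) -[degrees _](lfunE degrees).
  exact/memv_img/memvf.
rewrite capfv !dimvf !dim_matrix !mul1r => ->.
by rewrite -card_edge !mulSn mul0n addn0 addnA.
Qed.

Lemma triple_is_linear :
  [/\ linear (fun x => triple x 0 0), linear (fun y => triple 0 y 0)
   & linear (fun z => triple 0 0 z)].
Proof.
by split=> c v w; rewrite /triple !scale_row_mx !add_row_mx !scaler0 !addr0.
Qed.

(** The coupling constraint of an edge binds only if both tours use it. *)
Lemma tours_point s s' z : (2 < n)%N ->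
  hamiltonian s -> hamiltonian s' -> zero_one z ->
  (forall e, at_edge z e = 1 \/ at_edge (tour R s) e = 0) ->
  diameter_points (triple (tour R s) (tour R s') z).
Proof.
move=> n_gt2 s_ham s'_ham z01 z_free.
exists (tour R s), (tour R s'), z; split=> //; split; [|split; [|split]].
- by split; [|split]; try exact: zero_one_tour.
- by split; apply/degree_eqsE/degree_tour => //; apply: ltnW.
- by split; apply: subtour_ineqs_tour.
move=> i j /pair_edge[e eij]; rewrite !(at_pair_edge _ eij).
have := z_free e; have := zero_one_tour R n_gt2 s'_ham e.
have := zero_one_tour R n_gt2 s_ham e; have := z01 e.
by do 4![case=> ?]; lra.
Qed.

Lemma affine_hull_diameter_points : (4 <= n)%N ->
  exists p, affine_hull (@diameter_points R n) =
    [set v | v - p \in degree_ker]%classic.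
Proof.
move=> n_ge4; have n_gt2 : (2 < n)%N by apply: ltnW.
have [s s_ham] : exists s : 'I_n -> 'I_n, hamiltonian s.
  exists (next (enum 'I_n)); apply: hamiltonian_next; first exact: enum_uniq.
  by move=> i; rewrite mem_enum.
have all_ones s1 s2 : hamiltonian s1 -> hamiltonian s2 ->
    @diameter_points R n (triple (tour R s1) (tour R s2) (const_mx 1)).
  move=> h1 h2; apply: tours_point => // e; rewrite /at_edge mxE.
    by right.
  by left.
exists (triple (tour R s) (tour R s) (const_mx 1)).
have tripleB x y z x' y' z' :
    triple x y z - triple x' y' z' = triple (x - x') (y - y') (z - z').
  by rewrite /triple !opp_row_mx !add_row_mx.
apply: affine_hull_translate; first exact: all_ones.
  move=> _ [x [y [z [-> [_ [[/degree_eqsE x2 /degree_eqsE y2] _]]]]]] /=.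
  rewrite tripleB mem_degree_ker !linearB /= x2 y2.
  by rewrite !degree_tour ?subrr ?eqxx // ltnW.
move=> B B_aff B_points v; have [x [y [z ->]]] := tripleP v.
rewrite mem_degree_ker => /andP[/eqP x0 /eqP y0].
set p := triple (tour R s) _ _.
have Bp : B p by apply: B_points; apply: all_ones.
have dirB := affine_direction B_aff Bp.
have [lin1 lin2 lin3] := triple_is_linear.
have diffB x1 y1 z1 x2 y2 z2 : diameter_points (triple x1 y1 z1) ->
    diameter_points (triple x2 y2 z2) ->
    B (p + triple (x1 - x2) (y1 - y2) (z1 - z2)).
  move=> d1 d2; rewrite -tripleB.
  by apply: affine_set_diff => //; apply: B_points.
have -> : triple x y z = triple x 0 0 + triple 0 y 0 + triple 0 0 z.
  by rewrite /triple !add_row_mx !addr0 !add0r.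
have Qx : B (p + triple x 0 0).
  apply: (degree_ker_span _ (subspace_preim dirB lin1)) x0; first exact: ltnW.
  move=> i j k l /(tour_exchange R)[s1 [s2 [h1 h2 <-]]].
  have := diffB _ _ _ _ _ _ (all_ones _ _ h1 s_ham) (all_ones _ _ h2 s_ham).
  by rewrite !subrr.
have Qy : B (p + triple 0 y 0).
  apply: (degree_ker_span _ (subspace_preim dirB lin2)) y0; first exact: ltnW.
  move=> i j k l /(tour_exchange R)[s1 [s2 [h1 h2 <-]]].
  have := diffB _ _ _ _ _ _ (all_ones _ _ s_ham h1) (all_ones _ _ s_ham h2).
  by rewrite !subrr.
have Qz : B (p + triple 0 0 z).
  rewrite [z]row_sum_delta.
  apply: (subspace_sum (subspace_preim dirB lin3)) => k.
  (* A tour avoiding the edge k leaves its z coordinate free. *)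
  have [s' s'_ham s'k] := tour_avoiding R (enum_val k) n_ge4.
  have at_drop e :
      at_edge (const_mx 1 - 'e_k : 'rV[R]_E) e = (e != enum_val k)%:R.
    rewrite /at_edge !mxE eqxx /= -[k in LHS]enum_valK (inj_eq enum_rank_inj).
    by case: eqVneq => _; rewrite ?subrr ?subr0.
  have drop_k :
      diameter_points (triple (tour R s') (tour R s) (const_mx 1 - 'e_k)).
    apply: tours_point => // e; rewrite at_drop.
      by case: eqP; [left|right].
    by case: eqVneq => [->|_]; [right|left].
  have := diffB _ _ _ _ _ _ (all_ones _ _ s'_ham s_ham) drop_k.
  by rewrite !subrr subKr.
have BD v w : B (p + v) -> B (p + w) -> B (p + (v + w)) :=
  @subspaceD _ _ _ dirB v w.
exact: BD (BD _ _ Qx Qy) Qz.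
Qed.
End Polytope.

Theorem proposition4p3 (R : realType) (n : nat) (hn : (5 <= n)%N) :
  (affine_dim (@diameter_polytope R n))%:~R
    = (3 * n%:R ^+ 2 - 7 * n%:R) / 2 :> R.
Proof.
have n_ge4 : (4 <= n)%N by apply: ltnW.
have [p hull] := affine_hull_diameter_points R n_ge4.
rewrite (@affine_dim_translate _ _ _ p (degree_ker R n)); last first.
  by rewrite affine_hull_convex_hull.
have dim_ker := dim_degree_ker R (ltnW n_ge4).
have bin : ('C(n, 2) * 2 + n = n * n)%N.
  rewrite mulnC -mul_bin_diag bin1.
  by move: hn; case: (n) => // m _; rewrite -mulnSr.
move: (congr1 (fun m => m%:R : R) dim_ker) (congr1 (fun m => m%:R : R) bin).
rewrite -pmulrn !natrD !natrM /=; lra.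
Qed.
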